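(* Let $n \in \mathbb{N}$ and let $\{A_i\}_{i \in \mathcal{I}}$ be a finite collection of contracting, non-singular real upper triangular $n \times n$ matrices, with pressure $P$ and $\sigma$-ordered pressures $P_\sigma$ ($\sigma \in S_n$) defined from the diagonal entries of the $A_i$. Then for all $s \in [0,\infty)$, $$P(s) = \max_{\sigma \in S_n} P_\sigma(s).$$
   Context: The index set $\mathcal{I}$ is finite and non-empty, and $\mathcal{I}^* = \bigcup_{k \geq 1} \mathcal{I}^k$ is the set of all finite words over $\mathcal{I}$. For $\mathbf{i} = (i_1,\dots,i_k) \in \mathcal{I}^*$ write $A_{\mathbf{i}} = A_{i_1} A_{i_2} \cdots A_{i_k}$, and let $\alpha_1(\mathbf{i}) \geq \dots \geq \alpha_n(\mathbf{i}) > 0$ be the singular values of $A_{\mathbf{i}}$ (the positive square roots of the eigenvalues of $A_{\mathbf{i}}^T A_{\mathbf{i}}$, with multiplicity). A matrix is contracting if it is a contraction of $\mathbb{R}^n$ with the Euclidean norm, i.e. its largest singular value is strictly less than $1$. For $s \in [0,n)$, the singular value function is $$\phi^s(\mathbf{i}) = \alpha_1(\mathbf{i}) \cdots \alpha_m(\mathbf{i})\, \alpha_{m+1}(\mathbf{i})^{s-m},$$ where $m \in \{0,\dots,n-1\}$ is the unique integer with $m \leq s < m+1$. The pressure $P:[0,\infty) \to \mathbb{R}$ of $\{A_i\}_{i\in\mathcal{I}}$ is $$P(s) = \lim_{k \to \infty} \frac{1}{k} \log \sum_{\mathbf{i} \in \mathcal{I}^k} \phi^s(\mathbf{i}) \quad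 (0 \leq s < n), \qquad P(s) = \log \sum_{i \in \mathcal{I}} |\det A_i|^{s/n} \quad (s \geq n).$$ The limit exists because $\phi^s$ is submultiplicative: $\phi^s(\mathbf{i}\,\mathbf{j}) \leq \phi^s(\mathbf{i})\phi^s(\mathbf{j})$. Let $c_l(i) \in (0,1)$ denote the absolute value of the $l$-th diagonal entry of $A_i$ ($l = 1,\dots,n$), and let $S_n$ be the symmetric group on $\{1,\dots,n\}$. For $\sigma \in S_n$, $s \in [0,n)$ and $m$ the integer with $m \leq s < m+1$, put $$\phi^s_\sigma(i) = c_{\sigma(1)}(i) \cdots c_{\sigma(m)}(i)\, c_{\sigma(m+1)}(i)^{s-m} \quad (i \in \mathcal{I}).$$ The $\sigma$-ordered pressure $P_\sigma : [0,\infty) \to \mathbb{R}$ is $P_\sigma(s) = \log \sum_{i \in \mathcal{I}} \phi^s_\sigma(i)$ for $s \in [0,n)$, and $P_\sigma(s) = P(s)$ for $s \geq n$. *)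

(* Defs.v *)
From mathcomp Require Import all_boot all_order all_algebra all_fingroup.
From mathcomp Require Import all_classical all_reals all_analysis.
From mathcomp Require complex.
Import Order.TTheory GRing.Theory Num.Theory.
Import numFieldNormedType.Exports.

Set Implicit Arguments.
Unset Strict Implicit.
Unset Printing Implicit Defensive.

Local Open Scope classical_set_scope.
Local Open Scope ring_scope.

Section SingularValues.
Variables (R : realType) (n : nat).
Implicit Types B : 'M[R]_n.

(* The eigenvalues of [B^T *m B], counted with multiplicity (as roots of the
   characteristic polynomial) and listed in nonincreasing order.  The default
   [[::]] is never used: see [gram_eigenvaluesP]. *)
Definition gram_eigenvalues B : seq R :=
  xget [::] [set l : seq R | sorted >=%R l /\
    char_poly (B^T *m B) = \prod_(x <- l) ('X - x%:P)].

Definition singular_values B : seq R :=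
  [seq Num.sqrt x | x <- gram_eigenvalues B].

End SingularValues.

Section SingularValuesTheory.
Import complex.
Local Open Scope sesquilinear_scope.

Lemma char_poly_invmx_conj (F : fieldType) (n : nat) (P D : 'M[F]_n) :
  P \in unitmx -> char_poly (invmx P *m D *m P) = char_poly D.
Proof.
move=> Pu; rewrite /char_poly.
have -> : char_poly_mx (invmx P *m D *m P) =
  map_mx polyC (invmx P) *m char_poly_mx D *m map_mx polyC P.
  rewrite /char_poly_mx mulmxBr mulmxBl -!map_mxM /=; congr (_ - _).
  rewrite scalar_mxC -mulmxA -map_mxM mulVmx // map_mx1 mulmx1 //.
rewrite !det_mulmx mulrC mulrA -det_mulmx -map_mxM mulmxV // map_mx1 det1.
by rewrite mul1r.
Qed.

Lemma gram_char_poly_splits (R : realType) (n : nat) (A : 'M[R]_n) :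
  exists l : seq R, [/\ size l = n, all (>= 0) l &
   char_poly (A^T *m A) = \prod_(x <- l) ('X - x%:P)].
Proof.
pose rc : {rmorphism R -> R[i]} := real_complex R.
pose B := map_mx rc A; pose G := B^T *m B.
have BJ : B^t* = B^T.
  by apply/matrixP => i j; rewrite !mxE; exact: conjc_real.
have GH : G \is hermsymmx.
  apply/is_hermitianmxP; rewrite expr0 scale1r /G -[in RHS]BJ.
  by rewrite trmx_mul map_mxM trmxCK -[in LHS]BJ.
have /hermitian_normalmx/orthomx_spectralP := GH.
set P := spectralmx G; set d := spectral_diag G => GE.
have PU : P \is unitarymx by exact: spectral_unitarymx.
have Pu : P \in unitmx by exact: spectral_unit.
have d_ge0 j : 0 <= d 0 j.
  have : diag_mx d = (P *m B^T) *m (P *m B^T)^t*.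
    rewrite -[in RHS]BJ trmx_mul map_mxM trmxCK.
    rewrite mulmxA -[in RHS](mulmxA P) BJ -/G GE mulmxA.
    rewrite -(invmx_unitary PU) !mulmxA mulmxV // mul1mx -mulmxA mulmxV //.
    by rewrite mulmx1.
  move=> /matrixP/(_ j j); rewrite !mxE eqxx mulr1n => ->.
  by apply: sumr_ge0 => k _; rewrite !mxE mul_conjC_ge0.
exists [seq complex.Re (d 0 j) | j <- enum 'I_n]; split.
- by rewrite size_map size_enum_ord.
- apply/allP => _ /mapP[j _ ->]; have := d_ge0 j.
  by rewrite lecE => /andP[].
apply: (map_poly_inj rc).
rewrite map_char_poly map_mxM -matrix.map_trmx -/B -/G {1}GE char_poly_invmx_conj //.
rewrite char_poly_trig ?diag_mx_is_trig // big_map rmorph_prod /= big_enum.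
apply: eq_bigr => j _; rewrite rmorphB /= map_polyX map_polyC /=.
rewrite !mxE eqxx mulr1n; congr ('X - _%:P).
have := d_ge0 j; case: (d 0 j) => a b /=; rewrite lecE /= => /andP[/eqP -> _].
by [].
Qed.

Lemma gram_eigenvaluesP (R : realType) (n : nat) (B : 'M[R]_n) :
  sorted >=%R (gram_eigenvalues B) /\
  char_poly (B^T *m B) = \prod_(x <- gram_eigenvalues B) ('X - x%:P).
Proof.
have [l [_ _ lP]] := gram_char_poly_splits B.
apply: (@xgetPex _ [::] [set l : seq R | sorted >=%R l /\
  char_poly (B^T *m B) = \prod_(x <- l) ('X - x%:P)]).
exists (sort >=%R l); split; first by apply: sort_sorted => x y; exact: le_total.
by rewrite lP; apply/esym/perm_big; rewrite perm_sort.
Qed.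

Lemma singular_valuesP (R : realType) (n : nat) (B : 'M[R]_n) :
  [/\ size (singular_values B) = n, sorted >=%R (singular_values B),
      all (>= 0) (singular_values B) &
      char_poly (B^T *m B) =
        \prod_(x <- singular_values B) ('X - (x ^+ 2)%:P)].
Proof.
have [es eP] := gram_eigenvaluesP B.
have [l [sl l0 lP]] := gram_char_poly_splits B.
have e0 x : x \in gram_eigenvalues B -> 0 <= x.
  rewrite -root_prod_XsubC -eP lP root_prod_XsubC => xl.
  by move/allP: l0; exact.
split.
- by apply: succn_inj; rewrite size_map -(size_prod_XsubC _ id) -eP size_char_poly.
- by apply: homo_sorted es => x y; exact: ler_wsqrtr.
- by apply/allP => _ /mapP[x _ ->]; exact: sqrtr_ge0.
- rewrite eP big_map big_seq [RHS]big_seq.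
  by apply: eq_bigr => x /e0 x0; rewrite sqr_sqrtr.
Qed.

End SingularValuesTheory.

Section Pressure.
Variables (R : realType) (n : nat).
Implicit Types B : 'M[R]_n.

(* [is_trig_mx] is lower triangularity. *)
Definition upper_triangular B : bool := is_trig_mx B^T.

Definition contracting B : bool := (singular_values B)`_0 < 1.

(* For a list [a = (a_1, a_2, ...)], whose entries are indexed from 0 in Rocq:
   [a_1 ... a_m a_(m+1)^(s - m)], where [m <= s < m + 1]. *)
Definition interpolated_prod (a : seq R) (s : R) : R :=
  let m := Num.truncn s in
  (\prod_(j < m) a`_j) * a`_m `^ (s - m%:R).

Definition sv_function (s : R) B : R := interpolated_prod (singular_values B) s.

Definition ordered_sv_function (sigma : 'S_n) (s : R) B : R :=
  interpolated_prod [seq `|B (sigma l) (sigma l)| | l <- enum 'I_n] s.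

Variables (I : finType) (A : I -> 'M[R]_n).

Definition word_product (k : nat) (w : k.-tuple I) : 'M[R]_n :=
  \prod_(i <- w) A i.

Definition pressure (s : R) : R :=
  if s < n%:R then
    limn (fun k : nat =>
      k%:R^-1 * ln (\sum_(w : k.-tuple I) sv_function s (word_product w)))
  else ln (\sum_(i : I) `|\det (A i)| `^ (s / n%:R)).

Definition ordered_pressure (sigma : 'S_n) (s : R) : R :=
  if s < n%:R then ln (\sum_(i : I) ordered_sv_function sigma s (A i))
  else pressure s.

End Pressure.

(* Main.v *)
Require Import Defs.
From mathcomp Require Import all_boot all_order all_algebra all_fingroup.
From mathcomp Require Import all_classical all_reals all_analysis.
From mathcomp Require complex.
From mathcomp Require Import ring lra.

(** For [m <= n], the product of the [m] largest singular values of a matrix [B]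
    is comparable, up to constants depending only on [m] and [n], to the size of
    the [m]-minors of [B] ([sv_prefix_prod_le], [minor_le_sv_prefix_prod]): by
    Cauchy-Binet, [m`!] times the sum of the principal [m]-minors of [B^T *m B]
    is the sum of the squares of all [m]-minors of [B], while diagonalizing
    [B^T *m B] turns that sum of principal minors into an elementary symmetric
    function of the squared singular values.  Such constants disappear in the
    limit that defines the pressure.  Write [m] for the integer part of [s],
    and [t] for its fractional part; the singular value function is then the
    product of the [m] largest singular values, to the power [1 - t], times
    the product of the [m.+1] largest, to the power [t].

    Lower bound.  For an upper triangular matrix the principal minor on the
    indices [sigma 0, ..., sigma m.-1] is a product of diagonal entries, so the
    singular value function dominates the [sigma]-ordered one up to a constant.
    The latter is multiplicative on words, hence the sum over words of length [k]
    is at least a constant times the [k]-th power of the sum over letters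
    ([word_sum_lower]).

    Upper bound.  Expanding the minors of a word letter by letter bounds the sum
    over words of length [k] by the [k]-th power of a nonnegative matrix indexed
    by pairs of injections ['I_m -> 'I_n] and ['I_m.+1 -> 'I_n].  Since the
    letters are upper triangular, this matrix is triangular for the order given
    by the sum of the values of the injections, and so it grows like its largest
    diagonal entry ([triangular_growth], [word_sum_upper]).  A diagonal entry is
    a sum over letters of monomials in the diagonal entries [c_l], whose exponent
    vectors lie on a segment between two permutations of
    [(1, ..., 1, t, 0, ..., 0)] with [m] ones; by the weighted inequality of
    arithmetic and geometric means it is at most the largest of the sums that
    define the ordered pressures ([diagonal_interp_le]).

    The two bounds squeeze the normalized logarithms of the word sums
    ([growth_rate]), which also shows that the limit exists. *)

Import Order.TTheory GRing.Theory Num.Theory.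
Import numFieldNormedType.Exports.

Set Implicit Arguments.
Unset Strict Implicit.
Unset Printing Implicit Defensive.

Local Open Scope ring_scope.

(** * Minors and the Cauchy-Binet formula *)

Section Minors.
Variables (K : comNzRingType) (m n : nat).
Implicit Types (A B : 'M[K]_n) (f g h : 'I_m -> 'I_n).

(** Rows and columns are selected by maps instead of subsets, repetitions
    included, so that sums over all selections need no choice of orderings. *)
Definition minor A f g : K := \det (mxsub f g A).

Lemma minor_tr A f g : minor A^T f g = minor A g f.
Proof. by rewrite /minor -trmx_mxsub det_tr. Qed.

Lemma minor_perml A f g (s : 'S_m) :
  minor A (f \o s) g = (-1) ^+ s * minor A f g.
Proof.
rewrite /minor -det_perm -det_mulmx -row_permE.
by congr (\det _); apply/matrixP => i j; rewrite !mxE.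
Qed.

Lemma minor_eq0 A f g i1 i2 : i1 != i2 -> f i1 = f i2 -> minor A f g = 0.
Proof.
by move=> ne e; rewrite /minor (determinant_alternate ne) // => j; rewrite !mxE e.
Qed.

Lemma minor_noninj A (f : {ffun 'I_m -> 'I_n}) g :
  ~~ injectiveb f -> minor A f g = 0.
Proof. by case/injectivePn=> i1 [i2 ne e]; apply: minor_eq0 e. Qed.

(** Only the rows of the left factor are expanded, so that the coefficients
    are entries of a tensor power rather than minors. *)
Lemma minor_mulmx A B f g :
  minor (A *m B) f g =
    \sum_(h : {ffun 'I_m -> 'I_n}) (\prod_i A (f i) (h i)) * minor B h g.
Proof.
rewrite /minor /determinant.
under [RHS]eq_bigr => h _ do rewrite big_distrr /=.
rewrite exchange_big /=; apply: eq_bigr => s _.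
pose AB i j := A (f i) j * B j (g (s i)).
transitivity ((-1) ^+ s * \prod_i \sum_j AB i j).
  by congr (_ * _); apply: eq_bigr => i _; rewrite !mxE.
rewrite (bigA_distr_bigA AB) big_distrr /=; apply: eq_bigr => h _.
rewrite mulrCA big_split /=; congr (_ * (_ * _)).
by apply: eq_bigr => i _; rewrite mxE.
Qed.

(** The Cauchy-Binet formula, summed over all maps instead of all subsets:
    each subset of size [m] is counted [m`!] times. *)
Lemma cauchy_binet A B f g :
  m`!%:R * minor (A *m B) f g =
    \sum_(h : {ffun 'I_m -> 'I_n}) minor A f h * minor B h g.
Proof.
under [RHS]eq_bigr => h _ do rewrite {1}/minor /determinant big_distrl /=.
rewrite exchange_big /= -(card_Sn m) -sum1_card natr_sum big_distrl /=.
apply: eq_big => // s _; rewrite mul1r minor_mulmx.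
pose act (h : {ffun 'I_m -> 'I_n}) := [ffun i => h (s i)] : {ffun 'I_m -> 'I_n}.
have act_inj : injective act.
  move=> h1 h2 /ffunP e; apply/ffunP => i.
  by have := e (s^-1%g i); rewrite !ffunE permKV.
rewrite (reindex_inj act_inj); apply: eq_bigr => h _.
have -> : minor B (act h) g = (-1) ^+ s * minor B h g.
  rewrite -minor_perml; congr (\det _); apply/matrixP => i j.
  by rewrite !mxE ffunE.
rewrite mulrA [_ * (-1) ^+ s]mulrC; congr (_ * _ * _).
by apply: eq_bigr => i _; rewrite !mxE ffunE.
Qed.

(** This is [m`!] times the trace of the [m]-th compound matrix. *)
Definition minor_trace A : K :=
  \sum_(f : {ffun 'I_m -> 'I_n}) minor A f f.

Lemma minor_traceC A B :
  m`!%:R * minor_trace (A *m B) = m`!%:R * minor_trace (B *m A).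
Proof.
rewrite !big_distrr /=.
under eq_bigr => f _ do rewrite cauchy_binet.
under [RHS]eq_bigr => f _ do rewrite cauchy_binet.
rewrite exchange_big /=; apply: eq_bigr => f _; apply: eq_bigr => g _.
by rewrite mulrC.
Qed.

Lemma minor_diag_mx (d : 'rV[K]_n) (f : {ffun 'I_m -> 'I_n}) : injective f ->
  minor (diag_mx d) f f = \prod_j d 0 (f j).
Proof.
move=> f_inj; rewrite /minor det_trig; first by apply: eq_bigr => j _; rewrite !mxE eqxx.
apply/is_trig_mxP => i j ij; rewrite !mxE (inj_eq f_inj).
by rewrite -val_eqE /= ltn_eqF.
Qed.

Lemma minor_trace_diag_mx (d : 'rV[K]_n) :
  minor_trace (diag_mx d) =
    \sum_(f : {ffun 'I_m -> 'I_n} | injectiveb f) \prod_j d 0 (f j).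
Proof.
rewrite /minor_trace (bigID (fun f : {ffun 'I_m -> 'I_n} => injectiveb f)) /=.
rewrite [X in _ + X]big1 ?addr0 => [|f]; last exact: minor_noninj.
by apply: eq_bigr => f /injectiveP; exact: minor_diag_mx.
Qed.

End Minors.

(** Minor traces are conjugation invariant because they are cyclic; in
    characteristic zero the factorial in [minor_traceC] can be cancelled. *)
Lemma minor_trace_conj (K : numFieldType) (m n : nat) (P D : 'M[K]_n) :
  P \in unitmx -> minor_trace m (invmx P *m D *m P) = minor_trace m D.
Proof.
move=> Pu; have fact_neq0 : m`!%:R != 0 :> K by rewrite pnatr_eq0 -lt0n fact_gt0.
by apply: (mulfI fact_neq0); rewrite minor_traceC mulmxA mulmxV // mul1mx.
Qed.

(** * The Gram matrix and the singular values *)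

Section GramSpectrum.
Import complex.
Local Open Scope sesquilinear_scope.

(** The spectral theorem is used over the complex numbers; the eigenvalues it
    yields are the squared singular values up to order, because both families
    split the characteristic polynomial of the Gram matrix. *)
Lemma gram_diagonalization (R : realType) (n : nat) (B : 'M[R]_n) :
  let rc : {rmorphism R -> R[i]} := real_complex R in
  exists (P : 'M[R[i]]_n) (pi : 'S_n), P \in unitmx /\
    map_mx rc (B^T *m B) =
      invmx P *m diag_mx (\row_j rc ((singular_values B)`_(pi j) ^+ 2)) *m P.
Proof.
move=> rc; set G := map_mx rc _.
have GH : G \is hermsymmx.
  have GJ : G^t* = G^T by apply/matrixP => i j; rewrite !mxE; exact: conjc_real.
  apply/is_hermitianmxP; rewrite expr0 scale1r GJ /G.
  by rewrite matrix.map_trmx trmx_mul trmxK.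
have /hermitian_normalmx/orthomx_spectralP := GH.
set P := spectralmx G; set d := spectral_diag G => GE.
have Pu : P \in unitmx by exact: spectral_unit.
have [sz _ _ cp] := singular_valuesP B.
have : perm_eq [seq d 0 j | j <- enum 'I_n]
               [seq rc (x ^+ 2) | x <- singular_values B].
  apply: prod_XsubC_eq; rewrite [LHS]big_map [RHS]big_map big_enum /=.
  transitivity (char_poly G).
    rewrite GE char_poly_invmx_conj // char_poly_trig ?diag_mx_is_trig //.
    by apply: eq_bigr => j _; rewrite mxE eqxx mulr1n.
  rewrite /G -map_char_poly cp rmorph_prod /=.
  by apply: eq_bigr => x _; rewrite rmorphB /= map_polyX map_polyC.
have szt : size [seq rc (x ^+ 2) | x <- singular_values B] == n.
  by rewrite size_map sz.
rewrite -[X in perm_eq _ X]/(tval (Tuple szt)) => /tuple_permP[pi dE].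
exists P, pi; split; first exact: Pu.
rewrite [LHS]GE; congr (_ *m diag_mx _ *m _).
apply/rowP => j; rewrite !mxE.
have := congr1 (fun l => nth 0 l j) dE.
rewrite (nth_map j) ?size_enum_ord // nth_ord_enum => ->.
rewrite (nth_map j) ?size_enum_ord // nth_ord_enum (tnth_nth 0) /=.
by rewrite (nth_map 0) // sz.
Qed.

(** Both sides are [m`!] times the [m]-th elementary symmetric function of the
    eigenvalues of the Gram matrix; the left-hand side is invariant under
    conjugation, which reduces the claim to diagonal matrices. *)
Lemma gram_minor_trace (R : realType) (m n : nat) (B : 'M[R]_n) :
  minor_trace m (B^T *m B) =
    \sum_(f : {ffun 'I_m -> 'I_n} | injectiveb f)
      \prod_j (singular_values B)`_(f j) ^+ 2.
Proof.
have [P [pi [Pu GE]]] := gram_diagonalization B.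
pose rc : {rmorphism R -> R[i]} := real_complex R.
apply: (fmorph_inj rc).
have -> : rc (minor_trace m (B^T *m B)) = minor_trace m (map_mx rc (B^T *m B)).
  rewrite rmorph_sum /=; apply: eq_bigr => f _.
  by rewrite /minor -det_map_mx map_mxsub.
rewrite GE minor_trace_conj //.
rewrite minor_trace_diag_mx rmorph_sum /=.
pose act (f : {ffun 'I_m -> 'I_n}) :=
  [ffun j => pi^-1%g (f j)] : {ffun 'I_m -> 'I_n}.
have act_inj : injective act.
  move=> f g /ffunP e; apply/ffunP => j.
  by have := e j; rewrite !ffunE => /perm_inj.
rewrite (reindex_inj act_inj); apply: eq_big => f.
  apply/injectiveP/injectiveP => f_inj i j; last first.
    by rewrite !ffunE => /perm_inj/f_inj.
  by move=> e; apply: f_inj; rewrite !ffunE e.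
move=> _; rewrite rmorph_prod; apply: eq_bigr => j _.
by rewrite mxE ffunE permKV.
Qed.

End GramSpectrum.

Section TopSingularValues.
Variables (R : realType).

(** [S] has as many elements outside the first [m] indices as it misses among
    them, and [a] is no larger on the former than on the latter. *)
Lemma prod_set_le_prefix (n m : nat) (a : nat -> R) (S : {set 'I_n}) :
  (m <= n)%N -> #|S| = m ->
  (forall i : 'I_n, 0 <= a i) ->
  (forall i j : 'I_n, (i <= j)%N -> a j <= a i) ->
  \prod_(i in S) a i <= \prod_(i < m) a i.
Proof.
move=> mn cS a0 adec.
pose T := [set i : 'I_n | (i < m)%N].
have prodT : \prod_(i < m) a i = \prod_(i in T) a i.
  rewrite (big_ord_widen n a mn).
  by apply: eq_bigl => i; rewrite inE.
have cT : #|T| = m.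
  rewrite -sum1_card -[RHS]card_ord -sum1_card (big_ord_widen n (fun=> 1%N) mn).
  by apply: eq_bigl => i; rewrite inE.
rewrite prodT (big_setID T) [leRHS](big_setID S) /= finset.setIC.
apply: ler_wpM2l; first by apply: prodr_ge0 => i _.
have cD : #|S :\: T| = #|T :\: S| by rewrite !cardsD finset.setIC cS cT.
have [e|[i0 i0S]] := set_0Vmem (S :\: T).
  by move: cD; rewrite e cards0 => /esym/cards0_eq ->; rewrite !big_set0.
(* [a m.-1] separates the values on [S :\: T] from those on [T :\: S] *)
pose c := a m.-1.
have m0 : (0 < m)%N.
  rewrite -cS card_gt0; apply/set0Pn; exists i0.
  by move: i0S; rewrite inE => /andP[].
have mn' : (m.-1 < n)%N by rewrite prednK.
apply: (@le_trans _ _ (\prod_(i in S :\: T) c)).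
  apply: ler_prod => i; rewrite !inE -leqNgt => /andP[mi _]; rewrite a0 /=.
  by apply: (adec (Ordinal mn') i); rewrite /= (leq_trans _ mi) // leq_pred.
rewrite big_const cD -big_const.
apply: ler_prod => i; rewrite !inE => /andP[_ im].
rewrite (a0 (Ordinal mn')) /=.
by apply: (adec i (Ordinal mn')); rewrite /= -ltnS prednK.
Qed.

Lemma prod_inj_le_prefix (n m : nat) (a : nat -> R) (f : {ffun 'I_m -> 'I_n}) :
  injective f ->
  (forall i : 'I_n, 0 <= a i) ->
  (forall i j : 'I_n, (i <= j)%N -> a j <= a i) ->
  \prod_j a (f j) <= \prod_(i < m) a i.
Proof.
move=> f_inj a0 adec.
have mn : (m <= n)%N.
  by have := leq_card f f_inj; rewrite !card_ord.
have -> : \prod_j a (f j) = \prod_(i in f @: [set: 'I_m]) a i.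
  rewrite big_imset /=; first by apply: eq_bigl => j; rewrite inE.
  by move=> ? ? _ _; exact: f_inj.
by apply: prod_set_le_prefix => //; rewrite card_imset // cardsT card_ord.
Qed.

Variables (n : nat).
Implicit Types B : 'M[R]_n.

Definition sv_prefix_prod (m : nat) B : R :=
  \prod_(j < m) (singular_values B)`_j.

Lemma sv_ge0 B i : 0 <= (singular_values B)`_i.
Proof.
have [_ _ /allP sv0 _] := singular_valuesP B.
have [i_lt|i_ge] := ltnP i (size (singular_values B)); last by rewrite nth_default.
exact/sv0/mem_nth.
Qed.

Lemma sv_prefix_prod_ge0 m B : 0 <= sv_prefix_prod m B.
Proof. by apply: prodr_ge0 => j _; exact: sv_ge0. Qed.

Lemma sv_nonincreasing B (i j : nat) : (i <= j < n)%N ->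
  (singular_values B)`_j <= (singular_values B)`_i.
Proof.
have [sz srt _ _] := singular_valuesP B => /andP[ij jn].
by apply: (sorted_leq_nth ge_trans ge_refl _ srt); rewrite ?inE ?sz // (leq_ltn_trans ij).
Qed.

(** A principal minor of [B^T *m B] is, by Cauchy-Binet, a sum of squares of
    minors of [B]. *)
Lemma gram_minor_traceE m B :
  m`!%:R * minor_trace m (B^T *m B) =
    \sum_(f : {ffun 'I_m -> 'I_n}) \sum_(g : {ffun 'I_m -> 'I_n})
       minor B f g ^+ 2.
Proof.
rewrite /minor_trace big_distrr exchange_big /=; apply: eq_bigr => g _.
by rewrite cauchy_binet; apply: eq_bigr => f _; rewrite minor_tr.
Qed.

(** The sum of the absolute values along row [f] of the [m]-th compound matrix,
    each entry being repeated according to the orderings of its columns. *)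
Definition minor_row_norm m B (f : {ffun 'I_m -> 'I_n}) : R :=
  \sum_(g : {ffun 'I_m -> 'I_n}) `|minor B f g|.

Lemma minor_row_norm_ge0 m B f : 0 <= @minor_row_norm m B f.
Proof. exact: sumr_ge0. Qed.

Lemma sum_sqr_le (I : finType) (P : pred I) (F : I -> R) :
  (forall i, P i -> 0 <= F i) ->
  \sum_(i | P i) F i ^+ 2 <= (\sum_(i | P i) F i) ^+ 2.
Proof.
move=> F0; rewrite [leRHS]expr2 big_distrl /=.
apply: ler_sum => i Pi; rewrite expr2; apply: ler_wpM2l; first exact: F0.
by rewrite (bigD1 i) //= lerDl; apply: sumr_ge0 => j /andP[Pj _]; exact: F0.
Qed.

(** The square of the left-hand side is the term of [gram_minor_trace] given by
    the inclusion of the first [m] indices. *)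
Lemma sv_prefix_prod_le m B : (m <= n)%N ->
  sv_prefix_prod m B <=
    \sum_(f : {ffun 'I_m -> 'I_n} | injectiveb f) minor_row_norm B f.
Proof.
move=> mn.
have S0 : 0 <= \sum_(f : {ffun 'I_m -> 'I_n} | injectiveb f) minor_row_norm B f.
  by apply: sumr_ge0 => f _; exact: minor_row_norm_ge0.
rewrite -(ler_pXn2r (ltn0Sn 1)) ?nnegrE //; last exact: sv_prefix_prod_ge0.
apply: (@le_trans _ _ (minor_trace m (B^T *m B))).
  rewrite gram_minor_trace.
  pose f0 : {ffun 'I_m -> 'I_n} := [ffun j => widen_ord mn j].
  rewrite (bigD1 f0) /=; last first.
    apply/injectiveP => i j; rewrite !ffunE => /(congr1 val) /= e.
    exact: val_inj.
  rewrite /sv_prefix_prod -prodrXl.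
  have -> : \prod_(j < m) (singular_values B)`_j ^+ 2 =
            \prod_j (singular_values B)`_(f0 j) ^+ 2.
    by apply: eq_bigr => j _; rewrite ffunE.
  rewrite lerDl; apply: sumr_ge0 => f _.
  by apply: prodr_ge0 => j _; exact: sqr_ge0.
have fact_ge1 : 1 <= m`!%:R :> R by rewrite ler1n fact_gt0.
have tr0 : 0 <= minor_trace m (B^T *m B).
  rewrite gram_minor_trace; apply: sumr_ge0 => f _.
  by apply: prodr_ge0 => j _; exact: sqr_ge0.
apply: (@le_trans _ _ (m`!%:R * minor_trace m (B^T *m B))).
  by rewrite ler_peMl.
rewrite gram_minor_traceE.
apply: le_trans (sum_sqr_le _); last by move=> f _; exact: minor_row_norm_ge0.
rewrite (bigID (fun f : {ffun 'I_m -> 'I_n} => injectiveb f)) /=.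
rewrite [X in _ + X]big1 ?addr0; last first.
  by move=> f /minor_noninj f0; apply: big1 => g _; rewrite f0 expr0n.
apply: ler_sum => f _; apply: le_trans (sum_sqr_le _) => //.
by apply: ler_sum => g _; rewrite real_normK ?num_real.
Qed.

(** The first [m] indices give the largest term of [gram_minor_trace], which
    bounds the sum of the squares of all minors. *)
Lemma minor_le_sv_prefix_prod m B (f : {ffun 'I_m -> 'I_n}) :
  `|minor B f f| <= (m`! * #|{ffun 'I_m -> 'I_n}|)%:R * sv_prefix_prod m B.
Proof.
set c := (_ * _)%N.
have c0 : 0 <= c%:R * sv_prefix_prod m B.
  by rewrite mulr_ge0 ?ler0n ?sv_prefix_prod_ge0.
rewrite -(ler_pXn2r (ltn0Sn 1)) ?nnegrE // real_normK ?num_real //.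
apply: (@le_trans _ _ (m`!%:R * minor_trace m (B^T *m B))).
  rewrite gram_minor_traceE (bigD1 f) //= (bigD1 f) //= -addrA lerDl.
  by rewrite addr_ge0 // ?sumr_ge0 // => *; rewrite ?sumr_ge0 // => *; exact: sqr_ge0.
apply: (@le_trans _ _ (c%:R * sv_prefix_prod m B ^+ 2)); last first.
  rewrite exprMn; apply: ler_wpM2r; first exact: sqr_ge0.
  by rewrite -natrX ler_nat; case: (c) => // k; rewrite expnS leq_pmulr // expn_gt0.
rewrite /c natrM -mulrA; apply: ler_wpM2l => //.
rewrite gram_minor_trace mulr_natl -[leRHS]sumr_const.
rewrite [leRHS](bigID (fun g : {ffun 'I_m -> 'I_n} => injectiveb g)) /=.
apply: ler_wpDr; first by apply: sumr_ge0 => g _; exact: sqr_ge0.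
apply: ler_sum => g /injectiveP g_inj; rewrite /sv_prefix_prod -prodrXl.
apply: (@prod_inj_le_prefix n m (fun i => (singular_values B)`_i ^+ 2)) => //.
  by move=> i; exact: sqr_ge0.
move=> i j ij; rewrite ler_pXn2r ?nnegrE ?sv_ge0 //.
by apply: sv_nonincreasing; rewrite ij /=.
Qed.

End TopSingularValues.

(** * Inequalities for real powers *)

Section RealPowers.
Variable R : realType.
Implicit Types (a b t u : R).

Lemma weighted_AMGM a b t : 0 <= a -> 0 <= b -> 0 <= t < 1 ->
  a `^ (1 - t) * b `^ t <= (1 - t) * a + t * b.
Proof.
move=> a0 b0 /andP[]; rewrite le_eqVlt => /predU1P[<- _|t0 t1].
  by rewrite subr0 powRr1 // powRr0 mulr1 mul1r mul0r addr0.
have t1' : 0 < 1 - t by rewrite subr_gt0.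
have := @conjugate_powR R (a `^ (1 - t)) (b `^ t) (1 - t)^-1 t^-1.
rewrite !powR_ge0 !invr_gt0 !invrK subrK => /(_ isT isT t1' t0 erefl).
rewrite -!powRrM !mulfV ?gt_eqF // !powRr1 //.
by rewrite [a * _]mulrC [b * _]mulrC.
Qed.

Lemma powR_mul_interp a t : 0 <= a -> a `^ (1 - t) * a `^ t = a.
Proof. by move=> a0; rewrite -powRD subrK ?powRr1 // oner_eq0. Qed.

Lemma powR_interp a b t : 0 <= a -> 0 <= b ->
  a * b `^ t = a `^ (1 - t) * (a * b) `^ t.
Proof. by move=> a0 b0; rewrite powRM // mulrA powR_mul_interp. Qed.

(** With [S] the sum, each [F i / S] lies in the unit interval, where
    [x <= x `^ u].  An index is needed because [0 `^ 0 = 1]. *)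
Lemma powR_sum_le (T : finType) (P : pred T) (F : T -> R) u i0 :
  P i0 -> (forall i, P i -> 0 <= F i) -> 0 <= u <= 1 ->
  (\sum_(i | P i) F i) `^ u <= \sum_(i | P i) F i `^ u.
Proof.
move=> Pi0 F0 /andP[u0 u1]; set S := \sum_(i | P i) F i.
have S0 : 0 <= S by exact: sumr_ge0.
have [SE|S_neq0] := eqVneq S 0.
  rewrite SE; have [->|u_neq0] := eqVneq u 0; last first.
    by rewrite powR0 // sumr_ge0 // => i _; exact: powR_ge0.
  rewrite powRr0 (bigD1 i0) //= powRr0 lerDl sumr_ge0 // => i _.
  exact: powR_ge0.
have Sgt0 : 0 < S by rewrite lt_def S_neq0.
have -> : S `^ u = \sum_(i | P i) S `^ u * (F i / S).
  by rewrite -big_distrr -big_distrl /= -/S mulfV // mulr1.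
apply: ler_sum => i Pi.
have FS : F i = S * (F i / S) by rewrite mulrC divfK.
rewrite [in leRHS]FS powRM ?divr_ge0 ?F0 //.
apply: ler_wpM2l; first exact: powR_ge0.
have [->|F_neq0] := eqVneq (F i) 0; first by rewrite mul0r powR_ge0.
apply: ger1_powR => //; rewrite divr_gt0 ?lt_def ?F_neq0 ?F0 ?S_neq0 //=.
by rewrite ler_pdivrMr // mul1r /S (bigD1 i) //= lerDl sumr_ge0 // => j /andP[/F0].
Qed.

End RealPowers.

(** * Growth of triangular recursions *)

Section TriangularGrowth.
Variables (R : realType) (X : finType) (dom : pred X) (le : rel X) (r : X -> nat).
Variables (N : X -> X -> R) (F : nat -> X -> R) (L : R).
Hypothesis le_rank : forall x y, le x y -> y = x \/ (r x < r y)%N.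
Hypothesis N_ge0 : forall x y, 0 <= N x y.
Hypothesis N_diag : forall x, dom x -> N x x <= L.
Hypothesis F_rec : forall k x, dom x ->
  F k.+1 x <= \sum_(y | dom y && le x y) N x y * F k y.

(** The spectral radius of a nonnegative triangular matrix is its largest
    diagonal entry.  Weighting the coordinate [x] by [eta ^+ r x] multiplies
    every off-diagonal entry by at least one factor [eta], so that all row sums
    drop below [L + eps] once [eta] is small. *)
Lemma triangular_growth (eps : R) : 0 < eps ->
  exists2 C : R, 0 <= C & forall k x, dom x -> F k x <= C * (L + eps) ^+ k.
Proof.
move=> eps0; pose D := \sum_x \sum_y N x y.
have D0 : 0 <= D by do 2![apply: sumr_ge0 => ? _].
(* chosen so that both [eta <= 1] and [eta * D <= eps] *)
pose eta := eps / (D + 1 + eps).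
have den0 : 0 < D + 1 + eps by lra.
have eta0 : 0 < eta by exact: divr_gt0.
have eta1 : eta <= 1 by rewrite ler_pdivrMr // mul1r; lra.
have etaD : eta * D <= eps.
  rewrite mulrAC ler_pdivrMr //; apply: ler_wpM2l; first exact: ltW.
  by lra.
pose C := \sum_x `|F 0 x| / eta ^+ r x.
have C0 : 0 <= C.
  by apply: sumr_ge0 => x _; rewrite divr_ge0 // exprn_ge0 // ltW.
have row_sum x : dom x ->
    \sum_(y | dom y && le x y) N x y * eta ^+ r y <= (L + eps) * eta ^+ r x.
  move=> dx.
  have er0 : 0 <= eta ^+ r x by rewrite exprn_ge0 // ltW.
  apply: (@le_trans _ _ (\sum_y N x y * (eta ^+ r x * (if y == x then 1 else eta)))).
    rewrite big_mkcond /=; apply: ler_sum => y _; case: ifP => [/andP[_ xy]|_].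
      apply: ler_wpM2l => //; have [->|yx] := eqVneq y x; first by rewrite mulr1.
      have [/eqP|rxy] := le_rank xy; first by rewrite (negbTE yx).
      by rewrite -exprSr; apply: ler_wiXn2l; rewrite ?(ltW eta0).
    by rewrite !mulr_ge0 //; case: ifP => // _; exact: ltW.
  rewrite (bigD1 x) //= eqxx mulr1 mulrDl lerD ?ler_wpM2r ?N_diag //.
  under eq_bigr => y /negbTE -> do rewrite mulrCA.
  rewrite -big_distrr /= mulrC; apply: ler_wpM2r => //.
  rewrite -big_distrl /= mulrC; apply: le_trans etaD.
  apply: ler_wpM2l; first exact: ltW.
  rewrite /D [leRHS](bigD1 x) //=; apply: ler_wpDr.
    by do 2![apply: sumr_ge0 => ? _].
  by rewrite [leRHS](bigD1 x) //= lerDr.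
exists C => // k x dx.
have L0 : 0 <= L + eps.
  by rewrite addr_ge0 ?(ltW eps0) // (le_trans (N_ge0 x x)) // N_diag.
apply: (@le_trans _ _ (C * (L + eps) ^+ k * eta ^+ r x)); last first.
  rewrite ler_piMr ?mulr_ge0 ?exprn_ge0 //.
  by rewrite exprn_ile1 // ltW.
elim: k x dx => [|k IH] x dx.
  rewrite expr0 mulr1 -ler_pdivrMr ?exprn_gt0 //.
  apply: (@le_trans _ _ (`|F 0 x| / eta ^+ r x)).
    by apply: ler_wpM2r; rewrite ?ler_norm // invr_ge0 exprn_ge0 // ltW.
  rewrite /C (bigD1 x) //= lerDl sumr_ge0 // => y _.
  by rewrite divr_ge0 // exprn_ge0 // ltW.
apply: le_trans (F_rec k dx) _.
apply: (@le_trans _ _ (\sum_(y | dom y && le x y)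
    C * (L + eps) ^+ k * (N x y * eta ^+ r y))).
  apply: ler_sum => y /andP[dy _]; rewrite [leRHS]mulrCA.
  by apply: ler_wpM2l => //; exact: IH.
rewrite -big_distrr /=.
have -> : C * (L + eps) ^+ k.+1 * eta ^+ r x =
          C * (L + eps) ^+ k * ((L + eps) * eta ^+ r x) by rewrite exprSr !mulrA.
by apply: ler_wpM2l; rewrite ?mulr_ge0 ?exprn_ge0 // row_sum.
Qed.

End TriangularGrowth.

(** * Sums over words and growth rates *)

Section Words.
Variables (R : realType) (I : finType).

Lemma sum_tuple0 (F : seq I -> R) : \sum_(w : 0.-tuple I) F w = F [::].
Proof.
rewrite (bigD1 [tuple]) //= big1 ?addr0 // => w.
by move/eqP; case; exact: tuple0.
Qed.

Lemma sum_tuple_cons k (F : seq I -> R) :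
  \sum_(w : k.+1.-tuple I) F w = \sum_i \sum_(w : k.-tuple I) F (i :: w).
Proof.
rewrite pair_big /=.
rewrite (reindex (fun p : I * k.-tuple I => cons_tuple p.1 p.2)) //=.
exists (fun w : k.+1.-tuple I => (thead w, [tuple of behead w])).
  by move=> [i w] _ /=; congr pair; apply: val_inj.
by move=> w _; rewrite [w in RHS]tuple_eta; apply: val_inj.
Qed.

Lemma sum_words_prod k (F : I -> R) :
  \sum_(w : k.-tuple I) \prod_(i <- w) F i = (\sum_i F i) ^+ k.
Proof.
elim: k => [|k IH].
  by rewrite (sum_tuple0 (fun w => \prod_(i <- w) F i)) big_nil.
rewrite (sum_tuple_cons k (fun w => \prod_(i <- w) F i)) exprS -IH big_distrl /=.
by apply: eq_bigr => i _; rewrite big_distrr; apply: eq_bigr => w _; rewrite big_cons.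
Qed.

End Words.

Section GrowthRate.
Local Open Scope classical_set_scope.

(** Multiplicative constants contribute [O(1 / k)] after taking logarithms. *)
Lemma growth_rate (R : realType) (S : nat -> R) (l K : R) : 0 < K ->
  (forall k, K * expR l ^+ k <= S k) ->
  (forall d, 0 < d ->
     exists2 C : R, 0 <= C & forall k, S k <= C * expR (l + d) ^+ k) ->
  (fun k : nat => k%:R^-1 * ln (S k)) @ \oo --> l.
Proof.
move=> K0 lowS upS; apply/cvgrPdist_le => e e0.
have [C C0 upC] := upS (e / 2) ltac:(lra).
have S_gt0 k : 0 < S k.
  by apply: lt_le_trans (lowS k); rewrite mulr_gt0 // exprn_gt0 // expR_gt0.
have C_gt0 : 0 < C.
  by have := lt_le_trans (S_gt0 0%N) (upC 0%N); rewrite expr0 mulr1.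
pose M := `|ln K| + `|ln C|.
have M0 : 0 <= M by rewrite addr_ge0.
near=> k.
have k0 : (0 < k)%N by near: k; exact: nbhs_infty_gt.
have kR : 0 < k%:R :> R by rewrite ltr0n.
have kM : M <= (e / 2) * k%:R.
  rewrite mulrC -ler_pdivrMr; last by lra.
  by near: k; exact: nbhs_infty_ger.
have ln_geom D x : 0 < D -> ln (D * expR x ^+ k) = ln D + x * k%:R.
  move=> D0; rewrite lnM ?posrE ?exprn_gt0 ?expR_gt0 // lnXn ?expR_gt0 //.
  by rewrite expRK mulr_natr.
have lo : ln K + l * k%:R <= ln (S k).
  rewrite -ln_geom // ler_ln ?posrE //.
  by rewrite mulr_gt0 // exprn_gt0 // expR_gt0.
have up : ln (S k) <= ln C + (l + e / 2) * k%:R.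
  rewrite -ln_geom // ler_ln ?posrE //.
  by rewrite mulr_gt0 // exprn_gt0 // expR_gt0.
have K1 : - M <= ln K.
  by rewrite lerNl /M; apply: ler_wpDr => //; rewrite -normrN ler_norm.
have C1 : ln C <= M by rewrite /M; apply: ler_wpDl => //; exact: ler_norm.
rewrite -(ler_pM2r kR) -[X in _ * X <= _](gtr0_norm kR) -normrM mulrBl.
rewrite mulrAC mulVf ?gt_eqF // mul1r ler_norml.
by apply/andP; split; lra.
Unshelve. all: by end_near.
Qed.

End GrowthRate.

(** * Minors of upper triangular matrices *)

Section TriangularMinors.
Variables (R : realType) (n : nat).
Implicit Types B : 'M[R]_n.

Lemma upper_triangularP B :
  reflect (forall i j : 'I_n, (j < i)%N -> B i j = 0) (upper_triangular B).
Proof.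
apply: (iffP is_trig_mxP) => B0 i j ij; last by rewrite mxE B0.
by have := B0 _ _ ij; rewrite mxE.
Qed.

Lemma upper_triangular1 : upper_triangular (1%:M : 'M[R]_n).
Proof. by apply/upper_triangularP => i j ij; rewrite mxE -val_eqE gtn_eqF. Qed.

Lemma upper_triangularM B1 B2 :
  upper_triangular B1 -> upper_triangular B2 ->
  upper_triangular (B1 *m B2) /\
  forall i, (B1 *m B2) i i = B1 i i * B2 i i.
Proof.
move=> /upper_triangularP B10 /upper_triangularP B20; split.
  apply/upper_triangularP => i j ij; rewrite mxE big1 // => k _.
  have [ki|ik] := ltnP k i; first by rewrite B10 // mul0r.
  by rewrite B20 ?mulr0 // (leq_trans ij).
move=> i; rewrite mxE (bigD1 i) //= big1 ?addr0 // => k ki.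
have [{}ki|ik] := ltnP k i; first by rewrite B10 // mul0r.
by rewrite B20 ?mulr0 // ltn_neqAle eq_sym ki.
Qed.

(** A permutation [s] contributes to the Leibniz expansion only if
    [f i <= f (s i)] for all [i]; both sides have the same sum over [i], so
    they agree and [s] is the identity. *)
Lemma minor_upper_triangular m B (f : {ffun 'I_m -> 'I_n}) :
  upper_triangular B -> injective f -> minor B f f = \prod_j B (f j) (f j).
Proof.
move=> /upper_triangularP B0 f_inj; rewrite /minor /determinant.
rewrite (bigD1 1%g) //= odd_perm1 expr0 mul1r [X in _ + X]big1 ?addr0.
  by apply: eq_bigr => j _; rewrite mxE perm1.
move=> s s_neq1.
suff /existsP[i fi] : [exists i, (f (s i) < f i)%N].
  by rewrite (bigD1 i) //= mxE B0 // mul0r mulr0.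
apply: contraNT s_neq1; rewrite negb_exists => /forallP f_le.
have /leqif_sum[_] : forall i : 'I_m, true ->
    (f i <= f (s i) ?= iff (f i == f (s i) :> nat))%N.
  by move=> i _; apply: leqif_eq; rewrite leqNgt.
have -> : (\sum_i f (s i) = \sum_i f i)%N by rewrite [RHS](reindex_perm s).
rewrite eqxx => /esym/forallP fs.
by apply/eqP/permP => i; rewrite perm1; apply/esym/f_inj/val_inj/eqP/fs.
Qed.

(** Triangularity of [B] is inherited by the coefficients of the expansion: the maps
    [h] that occur dominate [f] pointwise, so [h = f] is the only one with the
    same sum of values, and its coefficient is a product of diagonal entries. *)
Lemma minor_row_norm_mulmx m B B' (f : {ffun 'I_m -> 'I_n}) :
  upper_triangular B ->
  minor_row_norm (B *m B') f <=
    \sum_(h : {ffun 'I_m -> 'I_n} | injectiveb h && [forall j, (f j <= h j)%N])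
      (\prod_j `|B (f j) (h j)|) * minor_row_norm B' h.
Proof.
move=> /upper_triangularP B0.
apply: (@le_trans _ _ (\sum_(h : {ffun 'I_m -> 'I_n})
    (\prod_j `|B (f j) (h j)|) * minor_row_norm B' h)).
  under [leRHS]eq_bigr => h _ do rewrite big_distrr /=.
  rewrite exchange_big /=; apply: ler_sum => g _; rewrite minor_mulmx.
  apply: le_trans (ler_norm_sum _ _ _) _; apply: ler_sum => h _.
  by rewrite normrM normr_prod.
rewrite [leLHS](bigID (fun h : {ffun 'I_m -> 'I_n} =>
  injectiveb h && [forall j, (f j <= h j)%N])) /=.
rewrite gerDl big1 // => h; rewrite negb_and => /orP[/minor_noninj h0|].
  by rewrite [minor_row_norm _ _]big1 ?mulr0 // => g _; rewrite h0 normr0.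
rewrite negb_forall => /existsP[j]; rewrite -ltnNge => hj.
by rewrite (bigD1 j) //= B0 ?normr0 ?mul0r.
Qed.

End TriangularMinors.

(** * The upper bound for sums over words *)

Section WordSums.
Variables (R : realType) (n : nat) (I : finType) (A : I -> 'M[R]_n).
Hypothesis A_trig : forall i, upper_triangular (A i).

Lemma word_product_triangular (w : seq I) :
  upper_triangular (\prod_(i <- w) A i) /\
  forall l, (\prod_(i <- w) A i) l l = \prod_(i <- w) A i l l.
Proof.
elim: w => [|i w [IHt IHd]].
  rewrite big_nil; split; first exact: upper_triangular1.
  by move=> l; rewrite big_nil mxE eqxx.
rewrite big_cons; have [T D] := upper_triangularM (A_trig i) IHt.
by split=> // l; rewrite big_cons -IHd; exact: D.
Qed.

(** Expanding the minors of a word letter by letter bounds the word sums by the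
    powers of a triangular matrix indexed by pairs of injections, ranked by the
    sum of their values. *)
Lemma word_sum_upper (m1 m2 : nat) (u1 u2 L eps : R) :
  (m1 <= n)%N -> (m2 <= n)%N -> 0 <= u1 <= 1 -> 0 <= u2 <= 1 ->
  (forall (f : {ffun 'I_m1 -> 'I_n}) (g : {ffun 'I_m2 -> 'I_n}),
     injective f -> injective g ->
     \sum_i (\prod_j `|A i (f j) (f j)|) `^ u1 *
            (\prod_j `|A i (g j) (g j)|) `^ u2 <= L) ->
  0 < eps ->
  exists2 C : R, 0 <= C & forall k,
    \sum_(w : k.-tuple I) sv_prefix_prod m1 (word_product A w) `^ u1 *
                          sv_prefix_prod m2 (word_product A w) `^ u2
      <= C * (L + eps) ^+ k.
Proof.
move=> m1n m2n u1_01 u2_01 diag_le eps0.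
have [[u1_ge0 _] [u2_ge0 _]] := (andP u1_01, andP u2_01).
pose X := ({ffun 'I_m1 -> 'I_n} * {ffun 'I_m2 -> 'I_n})%type.
pose dom (x : X) := injectiveb x.1 && injectiveb x.2.
pose le (x y : X) :=
  [forall j, (x.1 j <= y.1 j)%N] && [forall j, (x.2 j <= y.2 j)%N].
pose r (x : X) := (\sum_j x.1 j + \sum_j x.2 j)%N.
pose N (x y : X) := \sum_i (\prod_j `|A i (x.1 j) (y.1 j)|) `^ u1 *
                           (\prod_j `|A i (x.2 j) (y.2 j)|) `^ u2.
pose W (w : seq I) := \prod_(i <- w) A i.
pose G (x : X) (w : seq I) :=
  minor_row_norm (W w) x.1 `^ u1 * minor_row_norm (W w) x.2 `^ u2.
pose F k (x : X) := \sum_(w : k.-tuple I) G x w.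
have sum_eq_rank m (f h : {ffun 'I_m -> 'I_n}) : [forall j, (f j <= h j)%N] ->
    (\sum_j f j <= \sum_j h j ?= iff (h == f))%N.
  move=> /forallP fh.
  have := @leqif_sum _ xpredT (fun j => f j == h j) _ _
            (fun j _ => leqif_eq (fh j)).
  congr (_ <= _ ?= iff _)%N; apply/forallP/eqP => [e|-> j]; last exact: eqxx.
  by apply/ffunP => j; exact/esym/eqP/e.
have le_rank x y : le x y -> y = x \/ (r x < r y)%N.
  move=> /andP[le1 le2].
  have /leqifP := leqif_add (sum_eq_rank _ _ _ le1) (sum_eq_rank _ _ _ le2).
  case: ifP => [/andP[/eqP e1 /eqP e2] _|_ rlt]; last by right.
  by left; rewrite [y]surjective_pairing e1 e2 -surjective_pairing.
have N_ge0 x y : 0 <= N x y.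
  by apply: sumr_ge0 => i _; rewrite mulr_ge0 ?powR_ge0.
have N_diag x : dom x -> N x x <= L.
  by move=> /andP[/injectiveP f_inj /injectiveP g_inj]; exact: diag_le.
have row_norm_powR m u (f : {ffun 'I_m -> 'I_n}) i w : injectiveb f -> 0 <= u <= 1 ->
    minor_row_norm (W (i :: w)) f `^ u <=
    \sum_(h : {ffun 'I_m -> 'I_n} | injectiveb h && [forall j, (f j <= h j)%N])
      (\prod_j `|A i (f j) (h j)|) `^ u * minor_row_norm (W w) h `^ u.
  move=> f_inj u01; have [u0 _] := andP u01.
  have := minor_row_norm_mulmx (W w) f (A_trig i).
  rewrite /W big_cons -/(W w) => le_sum.
  have prod_ge0 (h : {ffun 'I_m -> 'I_n}) : 0 <= \prod_j `|A i (f j) (h j)|.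
    exact: prodr_ge0.
  apply: (@le_trans _ _ ((\sum_(h : {ffun 'I_m -> 'I_n} |
      injectiveb h && [forall j, (f j <= h j)%N])
      (\prod_j `|A i (f j) (h j)|) * minor_row_norm (W w) h) `^ u)).
    apply: ge0_ler_powR le_sum => //; rewrite nnegrE ?minor_row_norm_ge0 //.
    by apply: sumr_ge0 => h _; rewrite mulr_ge0 ?minor_row_norm_ge0.
  (* the range of the sum is not empty: it contains [f] itself *)
  apply: (le_trans (powR_sum_le (i0 := f) _ _ u01)).
  - by rewrite f_inj; apply/forallP.
  - by move=> h _; rewrite mulr_ge0 ?minor_row_norm_ge0.
  by apply: ler_sum => h _; rewrite powRM ?minor_row_norm_ge0.
have F_rec k x : dom x -> F k.+1 x <= \sum_(y | dom y && le x y) N x y * F k y.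
  case: x => f g /andP[/= f_inj g_inj].
  rewrite /F (sum_tuple_cons k (G (f, g))).
  pose a i (y : X) := (\prod_j `|A i (f j) (y.1 j)|) `^ u1 *
                      (\prod_j `|A i (g j) (y.2 j)|) `^ u2.
  apply: (@le_trans _ _ (\sum_i \sum_(w : k.-tuple I)
      \sum_(y | dom y && le (f, g) y) a i y * G y w)).
    apply: ler_sum => i _; apply: ler_sum => w _.
    apply: (le_trans (ler_pM (powR_ge0 _ _) (powR_ge0 _ _)
      (row_norm_powR _ _ _ i w f_inj u1_01) (row_norm_powR _ _ _ i w g_inj u2_01))).
    rewrite big_distrlr pair_big_dep /=.
    rewrite le_eqVlt; apply/orP; left; apply/eqP.
    apply: eq_big => [y|y _]; last by rewrite mulrACA.
    by rewrite /dom /le /= andbACA.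
  under [leLHS]eq_bigr => i _ do rewrite exchange_big /=.
  rewrite exchange_big /=; apply: ler_sum => y _.
  rewrite /N big_distrl /=; apply: ler_sum => i _.
  by rewrite big_distrr.
have [C C0 HC] := triangular_growth le_rank N_ge0 N_diag F_rec eps0.
exists (\sum_(x | dom x) C); first exact: sumr_ge0.
move=> k; rewrite big_distrl /=.
apply: (@le_trans _ _ (\sum_(x | dom x) F k x)); last first.
  by apply: ler_sum => x dx; exact: HC.
rewrite /F exchange_big /=; apply: ler_sum => w _.
have sv_le m u : (m <= n)%N -> 0 <= u <= 1 ->
    sv_prefix_prod m (word_product A w) `^ u <=
    \sum_(f : {ffun 'I_m -> 'I_n} | injectiveb f) minor_row_norm (W w) f `^ u.
  move=> mn u01; have [u0 _] := andP u01.
  have S0 : 0 <= \sum_(f : {ffun 'I_m -> 'I_n} | injectiveb f) minor_row_norm (W w) f.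
    by apply: sumr_ge0 => f _; exact: minor_row_norm_ge0.
  apply: le_trans (ge0_ler_powR u0 _ _ (sv_prefix_prod_le _ mn)) _;
    rewrite ?nnegrE ?sv_prefix_prod_ge0 //.
  apply: (powR_sum_le (i0 := [ffun j => widen_ord mn j])) => //.
    apply/injectiveP => i j; rewrite !ffunE => /(congr1 val) /= e.
    exact: val_inj.
  by move=> f _; exact: minor_row_norm_ge0.
apply: (le_trans (ler_pM (powR_ge0 _ _) (powR_ge0 _ _)
  (sv_le _ _ m1n u1_01) (sv_le _ _ m2n u2_01))).
by rewrite big_distrlr pair_big_dep.
Qed.

End WordSums.

(** * Ordered singular value functions *)

Section OrderedSingularValueFunction.
Variables (R : realType) (n : nat) (s : R).
Hypotheses (s_ge0 : 0 <= s) (s_lt_n : s < n%:R).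
Implicit Types B : 'M[R]_n.

Local Notation m := (Num.truncn s).
Local Notation t := (s - m%:R).

Lemma frac_part_itv : 0 <= t < 1.
Proof.
have /andP[ms sm] := truncn_itv s_ge0.
by rewrite subr_ge0 ms ltrBlDl natr1.
Qed.

Lemma int_part_lt : (m < n)%N.
Proof.
have /andP[ms _] := truncn_itv s_ge0.
by rewrite -(ltr_nat R) (le_lt_trans ms).
Qed.

Lemma sv_function_interp B :
  sv_function s B =
    sv_prefix_prod m B `^ (1 - t) * sv_prefix_prod m.+1 B `^ t.
Proof.
rewrite /sv_function /interpolated_prod /sv_prefix_prod big_ord_recr /=.
by apply: powR_interp; rewrite ?prodr_ge0 // => *; exact: sv_ge0.
Qed.

Local Notation first_index sigma j :=
  (sigma (widen_ord (ltnW int_part_lt) j)) (only parsing).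
Local Notation last_index sigma := (sigma (Ordinal int_part_lt)) (only parsing).

Lemma ordered_sv_functionE (sigma : 'S_n) B :
  ordered_sv_function sigma s B =
    (\prod_(j < m) `|B (first_index sigma j) (first_index sigma j)|) *
    `|B (last_index sigma) (last_index sigma)| `^ t.
Proof.
rewrite /ordered_sv_function /interpolated_prod.
have nthE (j : 'I_n) :
    [seq `|B (sigma l) (sigma l)| | l <- enum 'I_n]`_j = `|B (sigma j) (sigma j)|.
  by rewrite (nth_map j) ?size_enum_ord // nth_ord_enum.
rewrite (nthE (Ordinal int_part_lt)); congr (_ * _).
by apply: eq_bigr => j _; rewrite -nthE.
Qed.

Lemma perm_extending_seq (v : seq 'I_n) (x0 : 'I_n) : uniq v ->
  exists sigma : 'S_n, forall j : 'I_n, (j < size v)%N -> sigma j = nth x0 v j.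
Proof.
move=> v_uniq; pose u := v ++ [seq l <- enum 'I_n | l \notin v].
have u_uniq : uniq u.
  rewrite cat_uniq v_uniq filter_uniq ?enum_uniq // andbT.
  by apply/hasPn => l; rewrite mem_filter => /andP[].
have u_all l : l \in u.
  by rewrite mem_cat mem_filter mem_enum andbT orbN.
have u_size : size u = n.
  by rewrite -(card_uniqP u_uniq) (eq_card u_all) card_ord.
have nth_inj : injective (fun j : 'I_n => nth x0 u j).
  move=> i j /eqP; rewrite nth_uniq ?u_size // => /eqP.
  exact: val_inj.
by exists (perm nth_inj) => j jv; rewrite permE nth_cat jv.
Qed.

Lemma ordered_sv_function_seq (v : seq 'I_n) (b : 'I_n) :
  uniq v -> size v = m -> b \notin v ->
  exists sigma : 'S_n, forall B,
    ordered_sv_function sigma s B = (\prod_(l <- v) `|B l l|) * `|B b b| `^ t.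
Proof.
move=> v_uniq sz bv.
have vb_uniq : uniq (rcons v b) by rewrite rcons_uniq bv.
have [sigma sigmaE] := perm_extending_seq b vb_uniq.
have sigma_nth (j : 'I_n) : (j <= m)%N -> sigma j = nth b (rcons v b) j.
  by move=> jm; apply: sigmaE; rewrite size_rcons sz ltnS.
exists sigma => B; rewrite ordered_sv_functionE sigma_nth //= nth_rcons sz ltnn eqxx.
congr (_ * _); rewrite (big_nth b) sz big_mkord; apply: eq_bigr => j _.
by rewrite sigma_nth ?(ltnW (ltn_ord j)) //= nth_rcons sz ltn_ord.
Qed.

(** Writing [c l] for the size of the diagonal entry [l], choose an index [b]
    in the range of [g] but not of [f].  The exponent vector on the left is the
    convex combination, with weights [1 - t] and [t], of the exponent vectors of
    [\prod_j c (f j) * c b `^ t] and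
    [\prod_(j | g j != b) c (g j) * c b `^ t]. *)
Lemma diagonal_interp_le (f : {ffun 'I_m -> 'I_n}) (g : {ffun 'I_m.+1 -> 'I_n}) :
  injective f -> injective g ->
  exists sigma tau : 'S_n, forall B,
    (\prod_j `|B (f j) (f j)|) `^ (1 - t) * (\prod_j `|B (g j) (g j)|) `^ t <=
      (1 - t) * ordered_sv_function sigma s B + t * ordered_sv_function tau s B.
Proof.
move=> f_inj g_inj.
have [j0 j0f] : exists j0, g j0 \notin codom f.
  apply/existsP; apply: contraT; rewrite negb_exists => /forallP gf.
  have sub : {subset codom g <= codom f}.
    by move=> _ /codomP[j ->]; have := gf j; rewrite negbK.
  have := uniq_leq_size (_ : uniq (codom g)) sub.
  by rewrite !size_codom !card_ord ltnn => ->//; rewrite /codom map_inj_uniq ?enum_uniq.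
pose vg := [seq g j | j <- enum 'I_m.+1 & j != j0].
have vg_size : size vg = m.
  rewrite size_map -[RHS]/(m.+1.-1) -[in RHS](card_ord m.+1) -(cardC1 j0).
  by rewrite size_filter enumT cardE /enum_mem size_filter; apply: eq_count => j.
have [sigma sigmaE] : exists sigma : 'S_n, forall B,
    ordered_sv_function sigma s B =
    (\prod_j `|B (f j) (f j)|) * `|B (g j0) (g j0)| `^ t.
  have [||//|sigma sigmaE] := @ordered_sv_function_seq (codom f) (g j0).
  - by rewrite /codom map_inj_uniq ?enum_uniq.
  - by rewrite size_codom card_ord.
  exists sigma => B; rewrite sigmaE; congr (_ * _).
  by rewrite /codom big_map big_enum.
have [tau tauE] : exists tau : 'S_n, forall B,
    ordered_sv_function tau s B =
    (\prod_(j | j != j0) `|B (g j) (g j)|) * `|B (g j0) (g j0)| `^ t.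
  have [|//||tau tauE] := @ordered_sv_function_seq vg (g j0).
  - by rewrite map_inj_uniq // filter_uniq ?enum_uniq.
  - apply/mapP => -[j]; rewrite mem_filter => /andP[jj0 _] /g_inj e.
    by rewrite e eqxx in jj0.
  exists tau => B; rewrite tauE; congr (_ * _).
  by rewrite big_map big_filter big_enum_cond.
exists sigma, tau => B; rewrite sigmaE tauE.
set b := `|B (g j0) (g j0)|; set P := \prod_j _; set Q := \prod_(j | j != j0) _.
have P0 : 0 <= P by exact: prodr_ge0.
have Q0 : 0 <= Q by exact: prodr_ge0.
have b0 : 0 <= b by exact: normr_ge0.
refine (le_trans _ (weighted_AMGM _ _ frac_part_itv)); rewrite ?mulr_ge0 ?powR_ge0 //.
rewrite (bigD1 j0) //= -/b -/Q !powRM ?powR_ge0 //.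
rewrite -[X in X * Q `^ t](powR_mul_interp t (powR_ge0 b t)).
rewrite le_eqVlt; apply/orP; left; apply/eqP; ring.
Qed.

(** The ordered function is an interpolation between the principal minors on the
    first [m] and the first [m.+1] indices in the order [sigma]. *)
Lemma sv_function_lower (sigma : 'S_n) :
  exists2 K : R, 0 < K & forall B, upper_triangular B ->
    K * ordered_sv_function sigma s B <= sv_function s B.
Proof.
pose mn := int_part_lt; have [t0 t1] := andP frac_part_itv.
pose c k : R := (k`! * #|{ffun 'I_k -> 'I_n}|)%:R.
have c_gt0 k : (k <= n)%N -> 0 < c k.
  move=> kn; rewrite ltr0n muln_gt0 fact_gt0 /=; apply/card_gt0P.
  by exists [ffun j => widen_ord kn j].
have minor_le k (kn : (k <= n)%N) B : upper_triangular B ->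
    (c k)^-1 * (\prod_(j < k) `|B (sigma (widen_ord kn j)) (sigma (widen_ord kn j))|)
    <= sv_prefix_prod k B.
  move=> B_trig; pose f : {ffun 'I_k -> 'I_n} := [ffun j => sigma (widen_ord kn j)].
  have f_inj : injective f.
    by move=> i j; rewrite !ffunE => /perm_inj/(congr1 val) /= e; exact: val_inj.
  rewrite mulrC ler_pdivrMr ?c_gt0 // mulrC.
  apply: le_trans (minor_le_sv_prefix_prod B f).
  rewrite minor_upper_triangular // normr_prod le_eqVlt; apply/orP; left.
  by apply/eqP; apply: eq_bigr => j _; rewrite ffunE.
exists ((c m)^-1 `^ (1 - t) * (c m.+1)^-1 `^ t).
  by rewrite mulr_gt0 ?powR_gt0 ?invr_gt0 ?c_gt0 // ltnW.
move=> B B_trig; rewrite sv_function_interp.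
have cV0 k : 0 <= (c k)^-1 by rewrite invr_ge0 ler0n.
have -> : ordered_sv_function sigma s B =
    (\prod_(j < m) `|B (first_index sigma j) (first_index sigma j)|) `^ (1 - t) *
    (\prod_(j < m.+1) `|B (sigma (widen_ord mn j)) (sigma (widen_ord mn j))|) `^ t.
  rewrite ordered_sv_functionE big_ord_recr /= [LHS](powR_interp t) ?prodr_ge0 //.
  have -> : widen_ord mn ord_max = Ordinal int_part_lt by exact: val_inj.
  congr (_ * (_ * _) `^ _); apply: eq_bigr => j _.
  by congr `|B (sigma _) (sigma _)|; exact: val_inj.
rewrite mulrACA -!powRM ?prodr_ge0 //.
have powR_le k (kn : (k <= n)%N) u : 0 <= u ->
    ((c k)^-1 * \prod_(j < k)
      `|B (sigma (widen_ord kn j)) (sigma (widen_ord kn j))|) `^ u <=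
    sv_prefix_prod k B `^ u.
  move=> u0; apply: ge0_ler_powR => //; last exact: minor_le.
    by rewrite nnegrE mulr_ge0 ?prodr_ge0.
  by rewrite nnegrE sv_prefix_prod_ge0.
by apply: ler_pM; rewrite ?powR_ge0 ?powR_le // subr_ge0 ltW.
Qed.

End OrderedSingularValueFunction.

(** * The pressure formula *)

Lemma upper_triangular_diag_neq0 (R : realType) (n : nat) (B : 'M[R]_n) :
  upper_triangular B -> B \in unitmx -> forall l, B l l != 0.
Proof.
move=> B_trig; rewrite unitmxE unitfE -det_tr det_trig // => /prodf_neq0 B_diag l.
by have := B_diag l isT; rewrite mxE.
Qed.

Section OrderedWordSums.
Variables (R : realType) (n : nat) (s : R).
Hypotheses (s_ge0 : 0 <= s) (s_lt_n : s < n%:R).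

Lemma ordered_sv_function1 (sigma : 'S_n) :
  ordered_sv_function sigma s (1%:M : 'M[R]_n) = 1.
Proof.
rewrite (ordered_sv_functionE s_ge0 s_lt_n) mxE eqxx normr1 powR1 mulr1.
by rewrite big1 // => j _; rewrite mxE eqxx normr1.
Qed.

Lemma ordered_sv_functionM (sigma : 'S_n) (B1 B2 : 'M[R]_n) :
  upper_triangular B1 -> upper_triangular B2 ->
  ordered_sv_function sigma s (B1 *m B2) =
    ordered_sv_function sigma s B1 * ordered_sv_function sigma s B2.
Proof.
move=> T1 T2; have [_ D] := upper_triangularM T1 T2.
rewrite !(ordered_sv_functionE s_ge0 s_lt_n) D normrM powRM // mulrACA.
by rewrite -big_split /=; congr (_ * _); apply: eq_bigr => j _; rewrite D normrM.
Qed.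

Lemma ordered_sv_function_gt0 (sigma : 'S_n) (B : 'M[R]_n) :
  (forall l, B l l != 0) -> 0 < ordered_sv_function sigma s B.
Proof.
move=> B_diag; rewrite (ordered_sv_functionE s_ge0 s_lt_n) mulr_gt0 //.
  by apply: prodr_gt0 => j _; rewrite normr_gt0.
by rewrite powR_gt0 // normr_gt0.
Qed.

Variables (I : finType) (A : I -> 'M[R]_n).
Hypothesis A_trig : forall i, upper_triangular (A i).

Lemma ordered_sv_function_word (sigma : 'S_n) (w : seq I) :
  ordered_sv_function sigma s (\prod_(i <- w) A i) =
    \prod_(i <- w) ordered_sv_function sigma s (A i).
Proof.
elim: w => [|i w IH]; first by rewrite !big_nil; exact: ordered_sv_function1.
rewrite !big_cons -IH; apply: ordered_sv_functionM => //.
by have [] := word_product_triangular A_trig w.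
Qed.

Lemma word_sum_lower (sigma : 'S_n) :
  exists2 K : R, 0 < K & forall k,
    K * (\sum_i ordered_sv_function sigma s (A i)) ^+ k <=
      \sum_(w : k.-tuple I) sv_function s (word_product A w).
Proof.
have [K K0 HK] := sv_function_lower s_ge0 s_lt_n sigma.
exists K => // k; rewrite -sum_words_prod big_distrr /=.
apply: ler_sum => w _; rewrite -ordered_sv_function_word; apply: HK.
by have [] := word_product_triangular A_trig w.
Qed.

Lemma sv_word_sum_upper (L eps : R) :
  (forall sigma : 'S_n, \sum_i ordered_sv_function sigma s (A i) <= L) ->
  0 < eps ->
  exists2 C : R, 0 <= C & forall k,
    \sum_(w : k.-tuple I) sv_function s (word_product A w) <= C * (L + eps) ^+ k.
Proof.
move=> sum_le eps0; have /andP[t0 t1] := frac_part_itv s_ge0.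
have mn := int_part_lt s_ge0 s_lt_n.
pose t := s - (Num.truncn s)%:R.
have t_01 : 0 <= t <= 1 by rewrite t0 ltW.
have t'_01 : 0 <= 1 - t <= 1 by rewrite subr_ge0 gerBl t0 ltW.
have [|C C0 HC] := word_sum_upper A_trig (ltnW mn) mn t'_01 t_01 (L := L) _ eps0.
  move=> f g f_inj g_inj.
  have [sigma [tau fg_le]] := diagonal_interp_le s_ge0 s_lt_n f_inj g_inj.
  apply: le_trans (ler_sum _ (fun i _ => fg_le (A i))) _.
  rewrite big_split /= -!big_distrr /= -/t.
  apply: (@le_trans _ _ ((1 - t) * L + t * L)); last by rewrite -mulrDl subrK mul1r.
  by apply: lerD; apply: ler_wpM2l; rewrite ?sum_le // subr_ge0 ltW.
exists C => // k; apply: le_trans (HC k); apply: ler_sum => w _.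
by rewrite sv_function_interp.
Qed.

End OrderedWordSums.

Theorem mainTheorem4 (R : realType) (n : nat) (n_gt0 : (0 < n)%N)
    (I : finType) (I_gt0 : (0 < #|I|)%N) (A : I -> 'M[R]_n)
    (A_contr : forall i : I, contracting (A i))
    (A_unit : forall i : I, A i \in unitmx)
    (A_trig : forall i : I, upper_triangular (A i)) :
  forall s : R, 0 <= s ->
    pressure A s =
      \big[Num.max/ordered_pressure A 1%g s]_(sigma : 'S_n)
        ordered_pressure A sigma s.
Proof.
move=> s s_ge0; set l := \big[Num.max/_]_sigma _.
have l_ub sigma : ordered_pressure A sigma s <= l by exact: le_bigmax.
have [sigma0 l_att] : exists sigma, l = ordered_pressure A sigma s.
  rewrite /l; elim/big_ind: _ => [|x y [sx ->] [sy ->]|sigma _].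
  - by exists 1%g.
  - by rewrite /Num.max; case: ifP => _; [exists sy | exists sx].
  - by exists sigma.
have [s_lt_n|n_le_s] := ltP s n%:R; last first.
  by rewrite l_att /ordered_pressure ltNge n_le_s.
rewrite /ordered_pressure s_lt_n in l_ub l_att.
have sum_gt0 sigma : 0 < \sum_i ordered_sv_function sigma s (A i).
  have /card_gt0P[i0 _] := I_gt0.
  rewrite (bigD1 i0) //=.
  have gt0 i : 0 < ordered_sv_function sigma s (A i).
    exact/(ordered_sv_function_gt0 s_ge0 s_lt_n)/upper_triangular_diag_neq0.
  by rewrite ltr_wpDr // sumr_ge0 // => i _; exact: ltW.
rewrite /pressure s_lt_n; apply: cvg_lim => //.
have [K K0 lower] := word_sum_lower s_ge0 s_lt_n A_trig sigma0.
apply: (growth_rate K0) => [k|d d0].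
  by rewrite l_att lnK ?posrE //; exact: lower.
have eps0 : 0 < expR (l + d) - expR l by rewrite subr_gt0 ltr_expR ltrDl.
rewrite -[expR (l + d)](subrK (expR l)) addrC.
apply: sv_word_sum_upper => // sigma.
by rewrite -[leLHS]lnK ?posrE // ler_expR.
Qed.
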